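(* Let $\mathbf X_1,\mathbf X_2,\ldots$ be independent and identically distributed copies of a random vector $\mathbf X$ on $\mathbb R^d$ with continuous marginal distribution functions. Then, with $\mathrm{AUK}_j$ and $\widehat{\mathrm{AUK}}_{nj}$ as defined in the context, $$\widehat{\mathrm{AUK}}_{nj}\longrightarrow\mathrm{AUK}_j\quad\text{almost surely as } n\to\infty,\qquad\text{for all } j=1,\ldots,2^d.$$
   Context: Let $\varPi=U_1\cdots U_d$ with $U_1,\ldots,U_d$ i.i.d. uniform on $(0,1)$ and independent of $\mathbf X$, and $K_{\varPi}(t)=\Pr(\varPi\le t)$, i.e. $K_\varPi(t)=t\sum_{k=0}^{d-1}\frac{(-1)^k}{k!}\ln^k t$ for $0<t<1$. Let $\{-1,+1\}^d=\{\mathbf s_j\}_{j=1}^{2^d}$ be an enumeration of all sign vectors. For $j=1,\ldots,2^d$ put $\mathbf X^{(j)}=\operatorname{diag}(\mathbf s_j)\mathbf X$, let $F^{(j)}$ be its cumulative distribution function, $T_j=F^{(j)}(\mathbf X^{(j)})$, and $$\mathrm{AUK}_j=\Pr(T_j\le\varPi)=\mathbb E\{1-K_\varPi(T_j)\}.$$ For the sample $\mathbf X_1,\ldots,\mathbf X_n$ put $\mathbf X_{ij}=\operatorname{diag}(\mathbf s_j)\mathbf X_i$, and let $\mathbb F_{nj}(\mathbf x)=\frac1n\sum_{i=1}^n\mathbf 1\{\mathbf X_{ij}\le\mathbf x\}$, $\mathbf x\in\mathbb R^d$ (componentwise inequality), be the empirical distribution function. Then $$\widehat{\mathrm{AUK}}_{nj}=1-\frac1n\sum_{i=1}^nK_\varPi\left(\mathbb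 F_{nj}(\mathbf X_{ij})\right).$$ *)

(* Defs.v *)
From HB Require Import structures.
From mathcomp Require Import all_boot all_order all_algebra finmap.
From mathcomp Require Import all_classical all_reals all_analysis.
From mathcomp Require Import measurable_realfun.

Set Implicit Arguments.
Unset Strict Implicit.
Unset Printing Implicit Defensive.

Import Order.TTheory GRing.Theory Num.Theory.
Import numFieldNormedType.Exports.

Local Open Scope classical_set_scope.
Local Open Scope ring_scope.

(* Points of R^d are d.-tuple R, whose library sigma-algebra is generated by
   the coordinates, i.e. it is the Borel sigma-algebra of R^d. *)

Section measurable_maps.
Context {R : realType} {d : nat}.

Definition coordinate (k : 'I_d) (x : d.-tuple R) : R := tnth x k.

Definition diag_act (s x : d.-tuple R) : d.-tuple R :=
  [tuple tnth s k * tnth x k | k < d].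

Definition coord_prod (x : d.-tuple R) : R := \prod_(k < d) tnth x k.

Lemma measurable_coordinate k : measurable_fun setT (coordinate k).
Proof. exact: measurable_tnth. Qed.

Lemma measurable_diag_act s : measurable_fun setT (diag_act s).
Proof.
apply/measurable_fun_tnthP => k.
rewrite (_ : _ \o _ = fun x => tnth s k * coordinate k x).
  by apply: measurable_funM => //; exact: measurable_coordinate.
by apply/funext => x /=; rewrite tnth_mktuple.
Qed.

Lemma measurable_coord_prod : measurable_fun setT coord_prod.
Proof. by apply: measurable_prod => k _; exact: measurable_coordinate. Qed.

HB.instance Definition _ k :=
  isMeasurableFun.Build _ _ _ _ (coordinate k) (measurable_coordinate k).
HB.instance Definition _ s :=
  isMeasurableFun.Build _ _ _ _ (diag_act s) (measurable_diag_act s).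
HB.instance Definition _ :=
  isMeasurableFun.Build _ _ _ _ coord_prod measurable_coord_prod.

Definition letuple (x y : d.-tuple R) : bool :=
  [forall k, tnth x k <= tnth y k].

Definition sign_vectors : set (d.-tuple R) :=
  [set s | forall k, tnth s k = -1 \/ tnth s k = 1].

End measurable_maps.

Section probability_notions.
Context {disp : measure_display} {Omega : measurableType disp} {R : realType}.
Variable P : probability Omega R.

Definition mutually_independent (I : choiceType) (disp' : measure_display)
    (E : measurableType disp') (X : I -> Omega -> E) : Prop :=
  forall (J : {fset I}) (A : I -> set E), (forall i, measurable (A i)) ->
    P (\bigcap_(i in [set` J]) X i @^-1` A i) =
    (\prod_(i <- J) P (X i @^-1` A i))%E.

Definition independent_pair (disp1 disp2 : measure_display)
    (E1 : measurableType disp1) (E2 : measurableType disp2)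
    (X : Omega -> E1) (Y : Omega -> E2) : Prop :=
  forall A B, measurable A -> measurable B ->
    P (X @^-1` A `&` Y @^-1` B) = (P (X @^-1` A) * P (Y @^-1` B))%E.

Definition identically_distributed (disp' : measure_display)
    (E : measurableType disp') (X Y : {RV P >-> E}) : Prop :=
  forall A, measurable A -> distribution P X A = distribution P Y A.

Definition uniform01 (U : {RV P >-> R}) : Prop :=
  forall A, measurable A -> distribution P U A = uniform_prob ltr01 A.

Definition joint_cdf (d : nat) (Y : {RV P >-> d.-tuple R}) (x : d.-tuple R) :
    R :=
  fine (distribution P Y [set y | letuple y x]).

Definition real_cdf (V : {RV P >-> R}) (t : R) : R := fine (cdf V t).

(* Pr(T <= V) with T = F(Y); when V is independent of Y and has no atoms, this
   equals E(1 - K(T)) for K the distribution function of V. *)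
Definition AUK (d : nat) (V : {RV P >-> R}) (Y : {RV P >-> d.-tuple R}) : R :=
  fine (P [set w | joint_cdf Y (Y w) <= V w]).

End probability_notions.

Section empirical.
Context {R : realType} {d : nat}.

(* The sample of size n is y 0, ..., y (n - 1), stored in an infinite sequence
   so that n can tend to infinity. *)
Definition ecdf (n : nat) (y : nat -> d.-tuple R) (x : d.-tuple R) : R :=
  n%:R^-1 * \sum_(i < n) (letuple (y i) x)%:R.

Definition AUK_hat (K : R -> R) (n : nat) (y : nat -> d.-tuple R) : R :=
  1 - n%:R^-1 * \sum_(i < n) K (ecdf n y (y i)).

End empirical.

(* Main.v *)
Require Import Defs.
From mathcomp Require Import all_boot all_order all_algebra finmap.
From mathcomp Require Import all_classical all_reals all_analysis.
From mathcomp Require Import measurable_realfun.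
From mathcomp Require Import zify ring lra.
Import Order.TTheory GRing.Theory Num.Theory.
Import numFieldNormedType.Exports.

Set Implicit Arguments.
Unset Strict Implicit.
Unset Printing Implicit Defensive.

Local Open Scope classical_set_scope.
Local Open Scope ring_scope.

(** Write [Y_i] for the reflected sample, [F] and [F_n] for its joint and
    empirical distribution functions and [K] for the distribution function of
    the product [V] of the uniform variables. The estimator is one minus the
    mean of [K (F_n (Y_i))], and the target is [P (F Y <= V)], which by
    independence is one minus the expectation of [K (F Y)].

    - [F_n] converges to [F] uniformly, almost surely
      ([ecdf_uniform_close]). Since the marginals are continuous, they cut each
      axis into finitely many slices of small probability; every orthant
      [{z | z <= x}] is squeezed between two of the resulting finitely many
      corner sets, whose probabilities differ little ([corner_bracket]). On
      those finitely many sets the frequencies converge by the strong law.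

    - [K] is continuous, because [V] has no atoms ([prod_uniform_atomless]): a
      product of nonnegative coordinates increases strictly when all of them do,
      so each of its level sets meets at most one cell of a regular grid of mesh
      [1 / N] along every diagonal, which leaves probability at most [d / N].
      Hence [K] is uniformly continuous on [[0, 1]] and [F_n] may be replaced by
      [F] inside [K].

    - Cutting [[0, 1]] into bins for the value of [F], both the empirical mean
      and the target are close to the same step sum, of the values of [K] at
      the grid levels weighted by the frequencies, respectively the
      probabilities, of the bins ([mean_step_close], [AUK_step_close]). The
      strong law applied to the bins concludes ([AUK_hat_consistent]).

    The strong law is used for events only ([slln_events]): the second moment of
    the centred counts is at most [n], so the squared deviations of the
    frequencies are summable along the squares, and between
    consecutive squares a count cannot move much. Working with step sums
    throughout avoids the expectation of [K (F Y)]. *)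

(** * Real-valued probabilities *)

Section pr.
Context {disp : measure_display} {T : measurableType disp} {R : realType}.
Variable P : probability T R.

Definition pr (A : set T) : R := fine (P A).

Lemma prE A : measurable A -> P A = (pr A)%:E.
Proof. by move=> mA; rewrite /pr fineK// fin_num_measure. Qed.

Lemma integral_indic_pr A : measurable A ->
  (\int[P]_w (\1_A w)%:E = (pr A)%:E)%E.
Proof. by move=> mA; rewrite integral_indic// setIT; exact: prE. Qed.

Lemma pr_ge0 A : 0 <= pr A.
Proof. exact: fine_ge0. Qed.

Lemma pr_le1 A : measurable A -> pr A <= 1.
Proof. by move=> mA; rewrite -lee_fin -prE// probability_le1. Qed.

Lemma prT : pr setT = 1.
Proof. by rewrite /pr probability_setT. Qed.

Lemma pr0 : pr set0 = 0.
Proof. by rewrite /pr measure0. Qed.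

Lemma prC A : measurable A -> pr (~` A) = 1 - pr A.
Proof.
move=> mA; apply: EFin_inj.
by rewrite -prE ?probability_setC ?prE//; exact: measurableC.
Qed.

Lemma le_pr A B : measurable A -> measurable B -> A `<=` B -> pr A <= pr B.
Proof.
by move=> mA mB AB; rewrite -lee_fin -!prE//; apply: le_measure => //; exact: mem_set.
Qed.

Lemma prU A B : measurable A -> measurable B -> [disjoint A & B] ->
  pr (A `|` B) = pr A + pr B.
Proof.
move=> mA mB /disj_set2P AB; apply: EFin_inj.
by rewrite EFinD -!prE//; [exact: measureU | exact: measurableU].
Qed.

Lemma prU_le A B : measurable A -> measurable B ->
  pr (A `|` B) <= pr A + pr B.
Proof.
move=> mA mB; rewrite -lee_fin EFinD -!prE//; last exact: measurableU.
exact: measureU2.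
Qed.

Lemma pr_bigU_le (I : Type) (r : seq I) (Q : pred I) (A : I -> set T) :
  (forall i, measurable (A i)) ->
  pr (\big[setU/set0]_(i <- r | Q i) A i) <= \sum_(i <- r | Q i) pr (A i).
Proof.
move=> mA.
elim: r => [|i r IH]; first by rewrite !big_nil pr0.
rewrite !big_cons; case: ifP => // _; apply: le_trans (lerD (lexx _) IH).
by apply: prU_le => //; exact: bigsetU_measurable.
Qed.

Lemma pr_bigU (K : choiceType) (r : seq K) (Q : pred K) (A : K -> set T) :
  uniq r -> (forall i, measurable (A i)) -> trivIset setT A ->
  pr (\big[setU/set0]_(i <- r | Q i) A i) = \sum_(i <- r | Q i) pr (A i).
Proof.
move=> + mA tA; elim: r => [|i r IH /= /andP[ir ur]].
  by rewrite !big_nil pr0.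
rewrite !big_cons; case: ifP => // _; rewrite -IH// prU//.
  exact: bigsetU_measurable.
apply/disj_set2P; rewrite -subset0 => w [Ai].
rewrite -bigcup_seq_cond => -[j /= /andP[jr _] Aj].
by move: ir; rewrite (tA i j I I) ?jr//; exists w.
Qed.

Lemma pr_partition (n : nat) (J : 'I_n -> set T) (A : set T) :
  measurable A -> (forall i, measurable (J i)) -> trivIset setT J ->
  (forall w, exists i, J i w) -> pr A = \sum_(i < n) pr (A `&` J i).
Proof.
move=> mA mJ tJ cJ; rewrite -pr_bigU ?index_enum_uniq//.
- congr pr; rewrite -[LHS]setIT.
  rewrite (_ : setT = \big[setU/set0]_(i < n) J i) ?big_distrr//.
  apply/seteqP; split=> // w _; have [i Ji] := cJ w.
  by rewrite -bigcup_seq; exists i => //=; exact: mem_index_enum.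
- by move=> i; exact: measurableI.
- exact: trivIset_setIl.
Qed.

End pr.

(** * The strong law of large numbers for events *)

Section slln.
Context {disp : measure_display} {T : measurableType disp} {R : realType}.
Variables (P : probability T R) (B : nat -> set T) (p : R).
Hypothesis mB : forall i, measurable (B i).
Hypothesis pB : forall i, pr P (B i) = p.
Hypothesis indepB : forall i j, i != j -> pr P (B i `&` B j) = p ^+ 2.

Definition hits (n : nat) (w : T) : R := \sum_(i < n) \1_(B i) w.

Lemma measurable_hits n : measurable_fun setT (hits n).
Proof. by apply: measurable_sum => i; exact: measurable_indic. Qed.

Lemma hits_ge0 n w : 0 <= hits n w.
Proof. by apply: sumr_ge0 => i _; rewrite indicE. Qed.

Lemma integral_hits n : (\int[P]_w (hits n w)%:E = (n%:R * p)%:E)%E.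
Proof.
under eq_integral do rewrite /hits -sumEFin.
rewrite ge0_integral_sum//; last first.
  by move=> i; apply/measurable_EFinP; exact: measurable_indic.
rewrite (eq_bigr (fun=> p%:E)); last first.
  by move=> i _; rewrite integral_indic_pr// pB.
by rewrite sumEFin sumr_const card_ord mulr_natl.
Qed.

Lemma integral_hits2 n :
  (\int[P]_w (hits n w ^+ 2)%:E = (n%:R * p + n%:R * (n%:R - 1) * p ^+ 2)%:E)%E.
Proof.
have E w : (hits n w ^+ 2)%:E =
    (\sum_(i < n) \sum_(j < n) (\1_(B i `&` B j) w)%:E)%E.
  rewrite expr2 /hits mulr_suml -sumEFin; apply: eq_bigr => i _.
  rewrite mulr_sumr -sumEFin; apply: eq_bigr => j _.
  by rewrite indicI.
under eq_integral do rewrite E.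
rewrite ge0_integral_sum//; last first.
- by move=> i w _; apply: sume_ge0 => j _; rewrite lee_fin indicE.
- move=> i; apply: emeasurable_sum => j.
  by apply/measurable_EFinP; apply: measurable_indic; exact: measurableI.
rewrite (eq_bigr (fun=> (p + (n%:R - 1) * p ^+ 2)%:E)); last first.
  move=> i _; rewrite ge0_integral_sum//; last first.
    move=> j; apply/measurable_EFinP; apply: measurable_indic.
    exact: measurableI.
  rewrite (eq_bigr (fun j : 'I_n => (pr P (B i `&` B j))%:E)); last first.
    by move=> j _; rewrite integral_indic_pr//; exact: measurableI.
  rewrite sumEFin (bigD1 i)//= setIid pB; congr (_ + _)%:E.
  rewrite (eq_bigr (fun=> p ^+ 2)); last by move=> j ji; rewrite indepB 1?eq_sym.
  rewrite sumr_const -[(n%:R - 1)%R]/(n%:R - 1%:R) -natrB; last first.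
    by apply: leq_ltn_trans (ltn_ord i).
  by rewrite mulr_natl cardC1 card_ord subn1.
rewrite sumEFin sumr_const card_ord -mulr_natl; congr EFin; ring.
Qed.

(** The moments enter through [(S - c)^2 + 2 c S = S^2 + c^2], where every term
    is nonnegative, so that the integral is additive on both sides. *)
Lemma integral_dev2 n :
  (\int[P]_w ((hits n w - n%:R * p) ^+ 2)%:E <= n%:R%:E)%E.
Proof.
have p0 : 0 <= p by rewrite -(pB 0%N) pr_ge0.
have p1 : p <= 1 by rewrite -(pB 0%N) pr_le1.
have mh := measurable_hits n.
set c := n%:R * p.
have c0 : 0 <= c by rewrite mulr_ge0.
have md : measurable_fun setT (fun w => ((hits n w - c) ^+ 2)%:E).
  by apply/measurable_EFinP; apply: measurable_funX; exact: measurable_funB.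
have H : (\int[P]_w ((hits n w - c) ^+ 2)%:E + (2 * c * c)%:E =
    \int[P]_w (hits n w ^+ 2)%:E + (c ^+ 2)%:E)%E.
  have <- : (\int[P]_w ((2 * c)%:E * (hits n w)%:E) = (2 * c * c)%:E)%E.
    rewrite ge0_integralZl_EFin ?integral_hits ?EFinM ?mulr_ge0//.
    - by move=> w _; rewrite lee_fin hits_ge0.
    - exact/measurable_EFinP.
  have <- : (\int[P]_w (cst (c ^+ 2)%:E) w = (c ^+ 2)%:E)%E.
    rewrite integral_cst// [X in (_ * X)%E](_ : _ = 1%E) ?mule1//.
    exact: probability_setT.
  rewrite -!ge0_integralD//.
  - by apply: eq_integral => w _; rewrite -EFinM -!EFinD; congr EFin; ring.
  - by move=> w _; rewrite lee_fin sqr_ge0.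
  - by apply/measurable_EFinP; exact: measurable_funX.
  - by move=> w _; rewrite lee_fin sqr_ge0.
  - by move=> w _; rewrite lee_fin sqr_ge0.
  - by move=> w _; rewrite lee_fin !mulr_ge0// hits_ge0.
  - by apply/measurable_EFinP; exact: measurable_funM.
move: H; rewrite integral_hits2.
set I := (\int[P]_w _)%E.
have I0 : (0 <= I)%E by apply: integral_ge0 => w _; rewrite lee_fin sqr_ge0.
case: I I0 => [r| |]//.
rewrite lee_fin => r0 [] H; rewrite lee_fin.
have n0 : 0 <= n%:R :> R by [].
have -> : r = n%:R * (p * (1 - p)).
  by move: H; rewrite /c => H; lra.
by rewrite ler_piMr//; nra.
Qed.

Lemma sum_inv_sqr (n : nat) : \sum_(0 <= m < n) (m.+1%:R ^+ 2)^-1 <= 2 :> R.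
Proof.
case: n => [|n]; first by rewrite big_nil.
suff H : \sum_(0 <= m < n.+1) (m.+1%:R ^+ 2)^-1 <= 2 - n.+1%:R^-1 :> R.
  by rewrite (le_trans H)// lerBlDr lerDl invr_ge0.
(* 1 / (a + 1)^2 <= 1 / a - 1 / (a + 1) telescopes *)
elim: n => [|n IH]; first by rewrite big_nat1 expr1n invr1; lra.
rewrite big_nat_recr//=; apply: le_trans (lerD IH (lexx _)) _.
have a0 : 0 < n.+1%:R :> R by [].
rewrite -[n.+2]addn1 natrD; move: (n.+1%:R) a0 => a a0.
rewrite -subr_ge0.
have -> : 2 - (a + 1)^-1 - (2 - a^-1 + ((a + 1) ^+ 2)^-1) =
    (a * (a + 1) ^+ 2)^-1 :> R.
  by field; rewrite !gt_eqF ?addr_gt0.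
by rewrite invr_ge0 mulr_ge0 ?sqr_ge0 ?ltW.
Qed.

(** The squared deviation of the mean of the first [(m + 1)^2] indicators. *)
Let sqr_term (m : nat) (w : T) : R :=
  ((hits (m.+1 ^ 2) w - (m.+1 ^ 2)%:R * p) / (m.+1 ^ 2)%:R) ^+ 2.

Lemma measurable_sqr_term m : measurable_fun setT (EFin \o sqr_term m).
Proof.
apply/measurable_EFinP; apply: measurable_funX; apply: measurable_funM => //.
by apply: measurable_funB => //; exact: measurable_hits.
Qed.

(** The integrals of the squared deviations along the squares are dominated by
    [1 / (m + 1)^2], so their sum is integrable, hence almost surely finite. *)
Lemma ae_sqr_term_cvg0 : {ae P, forall w, sqr_term m w @[m --> \oo] --> 0}.
Proof.
have g0 m w : (0 <= (sqr_term m w)%:E)%E by rewrite lee_fin sqr_ge0.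
have ig m : (\int[P]_w (sqr_term m w)%:E <= ((m.+1%:R ^+ 2)^-1)%:E)%E.
  have k0 : 0 < (m.+1 ^ 2)%:R :> R by rewrite ltr0n expn_gt0.
  rewrite -natrX; set k := (m.+1 ^ 2)%N in k0 *.
  under eq_integral do rewrite /sqr_term -/k exprMn mulrC EFinM.
  rewrite ge0_integralZl_EFin ?sqr_ge0//.
  - apply: (@le_trans _ _ ((k%:R^-1 ^+ 2)%:E * k%:R%:E)%E).
      by rewrite lee_pmul2l ?lte_fin ?exprn_gt0 ?invr_gt0//; exact: integral_dev2.
    by rewrite -EFinM lee_fin expr2 -mulrA mulVf ?mulr1// gt_eqF.
  - by move=> w _; rewrite lee_fin sqr_ge0.
  - apply/measurable_EFinP; apply: measurable_funX.
    by apply: measurable_funB => //; exact: measurable_hits.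
have iS : (\int[P]_w \sum_(m <oo) (sqr_term m w)%:E < +oo)%E.
  rewrite integral_nneseries//; last exact: measurable_sqr_term.
  apply: (@le_lt_trans _ _ 2%:E); last exact: ltry.
  apply: lime_le.
    by apply: is_cvg_nneseries => m _ _; exact: integral_ge0.
  apply: nearW => n.
  apply: (@le_trans _ _ (\sum_(0 <= m < n) ((m.+1%:R ^+ 2)^-1)%:E)%E).
    exact: lee_sum.
  by rewrite sumEFin lee_fin sum_inv_sqr.
have mS : measurable_fun setT (fun w => \sum_(m <oo) (sqr_term m w)%:E)%E.
  by apply: ge0_emeasurable_sum => // m _; exact: measurable_sqr_term.
have : P.-integrable setT (fun w => \sum_(m <oo) (sqr_term m w)%:E)%E.
  apply/integrableP; split => //.
  under eq_integral do rewrite gee0_abs ?nneseries_ge0//.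
  exact: iS.
move=> /(integrable_ae measurableT); apply: filterS => w /(_ Logic.I) fw.
apply: cvg_series_cvg_0; apply: nnseries_is_cvg; first by move=> m; exact: sqr_ge0.
by rewrite -ge0_fin_numE//; apply: nneseries_ge0.
Qed.

End slln.

Lemma square_bracket (M n : nat) : (M.+1 ^ 2 <= n)%N ->
  exists2 m, (M <= m)%N & (m.+1 ^ 2 <= n < m.+2 ^ 2)%N.
Proof.
elim: n => [//|n IH].
rewrite leq_eqVlt => /orP[/eqP <-|].
  by exists M => //; rewrite leqnn/= ltn_sqr.
rewrite ltnS => /IH[m Mm /andP[mn nm]].
have [nm1|nm1] := ltnP n.+1 (m.+2 ^ 2); first by exists m => //; rewrite nm1 ltnW.
exists m.+1; first exact: ltnW.
by rewrite nm1 (leq_ltn_trans nm)// ltn_sqr.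
Qed.

(** With [k = (m + 1)^2], consecutive squares are only [2 m + 3] apart, so a
    sequence with increments in [[0, 1]] moves by at most [2 m + 2] between
    them, which is negligible against [k]. *)
Lemma cvg_mean_of_squares (R : realType) (S : nat -> R) (p : R) :
  0 <= p <= 1 -> (forall n, 0 <= S n.+1 - S n <= 1) ->
  ((S (m.+1 ^ 2)%N - (m.+1 ^ 2)%:R * p) / (m.+1 ^ 2)%:R) ^+ 2
    @[m --> \oo] --> 0 ->
  n%:R^-1 * S n @[n --> \oo] --> p.
Proof.
move=> /andP[p0 p1] S1 /cvgr0Pnorm_lt S2; apply/cvgrPdist_lt => e e0.
have e2 : 0 < e / 2 by lra.
have inc k i : 0 <= S (k + i)%N - S k <= i%:R.
  elim: i => [|i IH]; first by rewrite addn0 subrr lexx.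
  move: IH (S1 (k + i)%N); rewrite addnS [i.+1%:R]mulrS; lra.
have [M1 _ HM1] := S2 _ (exprn_gt0 2 e2).
have [M2 _ HM2] : \forall m \near \oo, 2 * m.+1%:R^-1 < e / 2.
  have : 2 * m.+1%:R^-1 @[m --> \oo] --> (2 * 0 : R).
    by apply: cvgMr; exact: cvg_harmonic.
  by rewrite mulr0 => /cvgr_lt; exact.
exists ((maxn M1 M2).+1 ^ 2)%N => // n /= /square_bracket[m].
rewrite geq_max => /andP[/HM1/= H1 /HM2/= H2] /andP[mn nm].
move: H1; set k := (m.+1 ^ 2)%N => H1.
have k0 : 0 < k%:R :> R by rewrite ltr0n expn_gt0.
have n0 : 0 < n%:R :> R by rewrite (lt_le_trans k0)// ler_nat.
have {}H1 : `|S k - k%:R * p| / k%:R < e / 2.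
  have x0 : 0 <= `|S k - k%:R * p| / k%:R by rewrite divr_ge0.
  rewrite -(ltr_pXn2r (n := 2)) ?nnegrE// ?(ltW e2)//.
  by move: H1; rewrite ger0_norm ?sqr_ge0// !expr_div_n real_normK ?num_real.
have [i ni] : exists i, n = (k + i)%N by exists (n - k)%N; rewrite subnKC.
have iM : i%:R / k%:R <= 2 * m.+1%:R^-1 :> R.
  have : (i <= 2 * m.+1)%N.
    by move: nm; rewrite ni /k -[m.+2]addn1 sqrnD; lia.
  rewrite -(ler_nat R) natrM /k natrX => iM.
  rewrite ler_pdivrMr ?exprn_gt0// expr2 mulrA divfK//.
have Sn : `|S n - n%:R * p| <= `|S k - k%:R * p| + i%:R.
  have -> : S n - n%:R * p = (S k - k%:R * p) + ((S n - S k) - i%:R * p).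
    by rewrite ni natrD; ring.
  rewrite (le_trans (ler_normD _ _))// lerD2l.
  have ip : 0 <= i%:R * p <= i%:R by rewrite mulr_ge0//= ler_piMr.
  by move: (inc k i) ip; rewrite -ni ler_norml; lra.
have -> : p - n%:R^-1 * S n = - ((S n - n%:R * p) / n%:R).
  by field; rewrite gt_eqF.
rewrite normrN normrM normfV (gtr0_norm n0).
apply: (@le_lt_trans _ _ ((`|S k - k%:R * p| + i%:R) / k%:R)); last first.
  by rewrite mulrDl [ltRHS]splitr ltr_leD// (le_trans iM)// ltW.
rewrite ler_pM// ?invr_ge0// lef_pV2 ?posrE// ler_nat ni leq_addr//.
Qed.

(** Pairwise independence is enough, since only second moments are used. *)
Theorem slln_events (disp : measure_display) (T : measurableType disp)
    (R : realType) (P : probability T R) (B : nat -> set T) (p : R) :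
  (forall i, measurable (B i)) -> (forall i, pr P (B i) = p) ->
  (forall i j, i != j -> pr P (B i `&` B j) = p ^+ 2) ->
  {ae P, forall w, n%:R^-1 * \sum_(i < n) \1_(B i) w @[n --> \oo] --> p}.
Proof.
move=> mB pB iB; have := ae_sqr_term_cvg0 mB pB iB.
apply: filterS => w; apply: cvg_mean_of_squares.
  by rewrite -(pB 0%N) pr_ge0 pr_le1.
move=> n; rewrite /hits big_ord_recr/= addrAC subrr add0r indicE.
by case: (_ \in _) => /=; lra.
Qed.

(** * Distribution functions of real random variables *)

Section real_cdf_theory.
Context {disp : measure_display} {T : measurableType disp} {R : realType}.
Variables (P : probability T R) (V : {RV P >-> R}).

Let mV : measurable_fun setT (V : T -> R).
Proof. exact: measurable_funPT. Qed.

Lemma measurable_le_cst (t : R) : measurable [set w | V w <= t].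
Proof. by rewrite -[X in measurable X]setTI; exact: measurable_fun_ler. Qed.

Lemma real_cdfE t : real_cdf V t = pr P [set w | V w <= t].
Proof.
by [].
Qed.

Lemma real_cdf_ge0 t : 0 <= real_cdf V t.
Proof. by rewrite real_cdfE pr_ge0. Qed.

Lemma real_cdf_le1 t : real_cdf V t <= 1.
Proof. by rewrite real_cdfE pr_le1//; exact: measurable_le_cst. Qed.

Lemma real_cdf_homo : {homo real_cdf V : s t / s <= t}.
Proof.
move=> s t st; rewrite !real_cdfE; apply: le_pr; [exact: measurable_le_cst..|].
by move=> w /= /le_trans; apply.
Qed.

Lemma continuous_real_cdf : continuous (cdf V) -> continuous (real_cdf V).
Proof.
by move=> cV t; apply: fine_cvg; rewrite fineK; [exact: cV|exact: fin_num_measure].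
Qed.

Lemma measurable_eq_cst (t : R) : measurable [set w | V w = t].
Proof.
by rewrite (_ : [set w | _] = V @^-1` [set t])//; exact: measurable_funPTI.
Qed.

Lemma pr_le_sub_cdf (A : set T) (s t : R) : measurable A ->
  A `<=` [set w | s < V w <= t] -> s <= t ->
  pr P A <= real_cdf V t - real_cdf V s.
Proof.
move=> mA As st; rewrite lerBrDr !real_cdfE.
have dA : [disjoint A & [set w | V w <= s]].
  apply/disj_set2P; rewrite -subset0 => w [/As/= /andP[sV _]].
  by rewrite /= leNgt sV.
rewrite -prU//; last exact: measurable_le_cst.
apply: le_pr; first by apply: measurableU => //; exact: measurable_le_cst.
- exact: measurable_le_cst.
- by move=> w [/As/= /andP[]//|/= /le_trans]; apply.
Qed.

(** An atom at [t] would be a jump of size at least its mass. *)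
Lemma atomless_of_continuous : continuous (real_cdf V) ->
  forall t, pr P [set w | V w = t] = 0.
Proof.
move=> cV t; apply/eqP; rewrite eq_le pr_ge0 andbT.
apply/ler_addgt0Pr => e e0; rewrite add0r.
have /cvgrPdist_lt/(_ _ e0)[d /= d0 Hd] := cV t.
have td : t - d / 2 < t by rewrite ltrBlDr ltrDl divr_gt0.
have := @pr_le_sub_cdf [set w | V w = t] (t - d / 2) t (measurable_eq_cst t).
move=> H; apply: le_trans (H _ (ltW td)) _; first by move=> w /= ->; rewrite td/=.
apply: le_trans (ler_norm _) (ltW (Hd _ _)).
by rewrite /= opprB addrC subrK gtr0_norm ?divr_gt0//; lra.
Qed.

(** The closed intervals of radius [1 / (n + 1)] around [t] decrease to the null
    event [V = t], and their probability bounds the variation near [t]. *)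
Lemma continuous_of_atomless : (forall t, pr P [set w | V w = t] = 0) ->
  continuous (real_cdf V).
Proof.
move=> aV t; apply/cvgrPdist_lt => e e0.
pose D n := [set w | `|V w - t| <= n.+1%:R^-1].
have mD n : measurable (D n).
  rewrite -[X in measurable X]setTI; apply: measurable_fun_ler => //.
  by apply: measurableT_comp => //; exact: measurable_funB.
have D0 : \bigcap_n D n = [set w | V w = t].
  apply/seteqP; split => w /=; last first.
    by move=> wt n _; rewrite /D/= wt subrr normr0 invr_ge0.
  move=> Dw; apply/eqP; rewrite -subr_eq0 -normr_le0 leNgt; apply/negP => a0.
  have : n.+1%:R^-1 @[n --> \oo] --> (0 : R) by exact: cvg_harmonic.
  move=> /cvgr_lt/(_ _ a0)[n _ /(_ n (leqnn n))/=]; apply/negP; rewrite -leNgt.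
  exact: Dw.
have : P (D n) @[n --> \oo] --> P (\bigcap_n D n).
  apply: nonincreasing_cvg_mu => //; first by rewrite -ge0_fin_numE// fin_num_measure.
    exact: bigcap_measurable.
  move=> m n mn; apply/subsetPset => w; rewrite /D/= => /le_trans; apply.
  by rewrite lef_pV2 ?posrE// ler_nat.
rewrite D0 (prE P (measurable_eq_cst t)) aV => /fine_cvg.
move=> /cvgr_lt/(_ _ e0)[n _ /(_ n (leqnn n))/= Dn].
exists n.+1%:R^-1 => /=; first by rewrite invr_gt0.
move=> s /= ts.
have L a b : `|t - a| <= n.+1%:R^-1 -> `|t - b| <= n.+1%:R^-1 -> a <= b ->
    real_cdf V b - real_cdf V a <= pr P (D n).
  move=> ta tb ab; rewrite lerBlDl !real_cdfE.
  have mU : measurable ([set w | V w <= a] `|` D n).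
    by apply: measurableU => //; exact: measurable_le_cst.
  rewrite (le_trans _ (prU_le P (measurable_le_cst a) (mD n)))//.
  apply: le_pr => //; first exact: measurable_le_cst.
  move=> w /= Vb; have [|aV'] := leP (V w) a; [by left|right].
  have between (r c v : R) : a < v -> v <= b -> `|c - a| <= r -> `|c - b| <= r ->
      `|v - c| <= r by rewrite !ler_norml; lra.
  exact: between ta tb.
apply: le_lt_trans Dn.
have tt : `|t - t| <= n.+1%:R^-1 by rewrite subrr normr0 invr_ge0.
have [st|/ltW st] := leP s t.
  by rewrite ger0_norm ?subr_ge0 ?real_cdf_homo// L// ltW.
by rewrite ler0_norm ?subr_le0 ?real_cdf_homo// opprB L// ltW.
Qed.

Lemma real_cdf_surj : continuous (real_cdf V) ->
  forall v, 0 < v < 1 -> exists q, real_cdf V q = v.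
Proof.
move=> cV v /andP[v0 v1].
have [b vb] : exists b, v < real_cdf V b.
  have /fine_cvg/cvgr_gt/(_ _ v1)[M [_ HM]] := cvg_cdfy1 V.
  by exists (M + 1); apply: HM; rewrite ltrDl.
have [a av] : exists a, real_cdf V a < v.
  have /fine_cvg/cvgr_lt/(_ _ v0)[M [_ HM]] := cvg_cdfNy0 V.
  by exists (M - 1); apply: HM; rewrite ltrBlDr ltrDl.
have ab : a <= b.
  rewrite leNgt; apply/negP => /ltW /real_cdf_homo ba.
  by have := lt_trans av vb; rewrite ltNge ba.
have [|q _ qv] := @IVT R (real_cdf V) a b v ab (continuous_subspaceT cV).
  by rewrite minEle maxEle real_cdf_homo// !ltW.
by exists q.
Qed.

Lemma measurable_real_cdf : measurable_fun setT (real_cdf V).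
Proof. by apply: nondecreasing_measurable => //; exact: real_cdf_homo. Qed.

Lemma measurable_cdf_lt (v : R) : measurable [set w | real_cdf V (V w) < v].
Proof.
rewrite -[X in measurable X]setTI; apply: measurable_fun_ltr => //.
exact: measurableT_comp measurable_real_cdf mV.
Qed.

(** Half of the probability integral transform: a continuous distribution
    function takes the value [v] at some [q], and [F V < F q] forces
    [V <= q]. *)
Lemma pr_cdf_lt_le (v : R) : continuous (real_cdf V) -> 0 < v ->
  pr P [set w | real_cdf V (V w) < v] <= v.
Proof.
move=> cV v0; have [v1|v1] := leP 1 v.
  by rewrite (le_trans _ v1)// pr_le1//; exact: measurable_cdf_lt.
have [|q qv] := real_cdf_surj cV (v := v); first by rewrite v0.
rewrite -[leRHS]qv [leRHS]real_cdfE; apply: le_pr.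
- exact: measurable_cdf_lt.
- exact: measurable_le_cst.
- move=> w /=; rewrite -qv; apply: contraTT; rewrite -ltNge -leNgt.
  by move=> /ltW/real_cdf_homo.
Qed.

(** The other half. The slack [u < v] replaces a limiting argument. *)
Lemma pr_cdf_lt_ge (u v : R) : continuous (real_cdf V) -> u < v -> u < 1 ->
  u <= pr P [set w | real_cdf V (V w) < v].
Proof.
move=> cV uv u1; have [u0|u0] := leP u 0.
  by rewrite (le_trans u0) ?pr_ge0.
have [|q qu] := real_cdf_surj cV (v := u); first by rewrite u0.
rewrite -[leLHS]qu [leLHS]real_cdfE; apply: le_pr.
- exact: measurable_le_cst.
- exact: measurable_cdf_lt.
- by move=> w /= Vq; rewrite (le_lt_trans (real_cdf_homo Vq))// qu.
Qed.

(** The sharp bound is [1 / (N + 1)]; the slack in [pr_cdf_lt_ge], taken equal to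
    one mesh, accounts for the factor 2. *)
Lemma pr_cdf_bucket (N m : nat) : continuous (real_cdf V) -> (m <= N.+1)%N ->
  pr P [set w | m%:R / N.+1%:R <= real_cdf V (V w) < m.+1%:R / N.+1%:R]
    <= 2 / N.+1%:R.
Proof.
move=> cV mN.
have N0 : 0 < N.+1%:R :> R by [].
pose v : R := m.+1%:R / N.+1%:R; pose u : R := m%:R / N.+1%:R.
rewrite -/v -/u.
have v0 : 0 < v by rewrite divr_gt0.
have u1 : u - N.+1%:R^-1 < 1.
  rewrite ltrBlDr (@le_lt_trans _ _ 1)//; last by rewrite ltrDl invr_gt0.
  by rewrite ler_pdivrMr// mul1r ler_nat.
have uu : u - N.+1%:R^-1 < u by rewrite ltrBlDr ltrDl invr_gt0.
have H1 := pr_cdf_lt_le cV v0.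
have H2 := pr_cdf_lt_ge cV uu u1.
have vu : v = u + N.+1%:R^-1 by rewrite /v /u [m.+1%:R]mulrS mulrDl mul1r addrC.
set A := [set w | _].
have mA : measurable A.
  rewrite (_ : A = [set w | real_cdf V (V w) < v] `\`
      [set w | real_cdf V (V w) < u]).
    by apply: measurableD; exact: measurable_cdf_lt.
  apply/seteqP; split => w; rewrite /A/=.
    by move=> /andP[a ->]; split=> //; rewrite ltNge a.
  by move=> [-> /negP]; rewrite -leNgt andbT.
have dA : [disjoint A & [set w | real_cdf V (V w) < u]].
  apply/disj_set2P; rewrite -subset0 => w [/= /andP[+ _]].
  by rewrite leNgt => /negP.
have := prU P mA (measurable_cdf_lt u) dA.
have : pr P (A `|` [set w | real_cdf V (V w) < u]) <=
    pr P [set w | real_cdf V (V w) < v].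
  apply: le_pr; first by apply: measurableU => //; exact: measurable_cdf_lt.
  - exact: measurable_cdf_lt.
  - move=> w [/andP[]//|/= /lt_trans]; apply; rewrite vu ltrDl invr_gt0//.
move=> H3 H4.
rewrite -(lerD2r (pr P [set w | real_cdf V (V w) < u])) -H4 (le_trans H3)//.
rewrite (le_trans H1)// vu; apply: (le_trans _ (lerD (lexx _) H2)).
have -> : 2 / N.+1%:R = N.+1%:R^-1 + N.+1%:R^-1 :> R by rewrite mulr_natl mulr2n.
by rewrite [leRHS]addrC -addrA lerD2l addrA addNr add0r.
Qed.

End real_cdf_theory.

(** Uniform continuity in the form used below: only one of the two points has to
    lie in the segment. *)
Lemma heine_segment (R : realType) (f : R -> R) (a b : R) : continuous f ->
  forall e, 0 < e -> exists2 d, 0 < d &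
    forall x y, a <= x <= b -> `|x - y| < d -> `|f x - f y| < e.
Proof.
move=> cf e e0.
have e2 : 0 < e / 2 by rewrite divr_gt0.
have /compact_near_coveringP := @segment_compact R a b.
pose Q (d x : R) := forall y, `|x - y| < d -> `|f x - f y| < e.
move=> /(_ R 0^'+ Q _)[|d /= d0 Hd].
  move=> x _.
  have /cvgrPdist_lt/(_ _ e2)[d /= d0 Hd] := cf x.
  exists (ball x (d / 2), [set z | z < d / 2]) => /=.
    split; first by apply: nbhsx_ballx; rewrite divr_gt0.
    by apply: nbhs_right_lt; rewrite divr_gt0.
  move=> [x' d'] /= [xx' dd'] y x'y.
  have H1 : `|f x - f x'| < e / 2 by apply: Hd => /=; rewrite (lt_trans xx')//; lra.
  have H2 : `|f x - f y| < e / 2.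
    apply: Hd => /=; rewrite -(subrK x' x) -addrA (le_lt_trans (ler_normD _ _))//.
    by move: xx'; rewrite /ball/=; lra.
  by move: H1 H2; rewrite !ltr_norml; lra.
(* the near statement holds below d, and the radius must be strictly less *)
exists (d / 2); first by rewrite divr_gt0.
move=> x y xab xy.
have := Hd (d / 2); rewrite /= sub0r normrN gtr0_norm ?divr_gt0//.
by apply => //; rewrite ?in_itv//= ?divr_gt0//; lra.
Qed.

(** * Regular grids of the unit interval *)

Section level.
Context {R : realType} (N : nat).

Definition level (i : nat) : R := i%:R / N.+1%:R.

Lemma level_ge0 i : 0 <= level i.
Proof. by rewrite divr_ge0. Qed.

Lemma ler_level i j : (level i <= level j) = (i <= j)%N.
Proof. by rewrite ler_pM2r ?invr_gt0// ler_nat. Qed.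

Lemma ltr_level i j : (level i < level j) = (i < j)%N.
Proof. by rewrite ltr_pM2r ?invr_gt0// ltr_nat. Qed.

Lemma levelS i : level i.+1 = level i + N.+1%:R^-1.
Proof. by rewrite /level [i.+1%:R]mulrS mulrDl mul1r addrC. Qed.

Lemma level_bracket (x : R) : 0 <= x ->
  exists i : nat, level i <= x < level i.+1.
Proof.
move=> x0; exists (Num.truncn (x * N.+1%:R)).
have /andP[x1 x2] : (Num.truncn (x * N.+1%:R))%:R <= x * N.+1%:R <
    (Num.truncn (x * N.+1%:R)).+1%:R by apply: truncn_itv; rewrite mulr_ge0.
by rewrite /level ler_pdivrMr// x1 ltr_pdivlMr.
Qed.

Lemma level_le1 i : (level i <= 1) = (i <= N.+1)%N.
Proof. by rewrite /level ler_pdivrMr// mul1r ler_nat. Qed.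

Lemma level_lt1 i : (level i < 1) = (i <= N)%N.
Proof. by rewrite /level ltr_pdivrMr// mul1r ltr_nat ltnS. Qed.

End level.

(** * A product of independent uniform variables has no atoms *)

Section uniform_product.
Context {disp : measure_display} {T : measurableType disp} {R : realType}.
Variables (P : probability T R) (d : nat) (d_gt0 : (0 < d)%N).
Variable U : 'I_d -> {RV P >-> R}.
Hypothesis unifU : forall k, uniform01 (U k).
Hypothesis indepU : mutually_independent P (fun k => U k : T -> R).

Lemma uniform_prob_subitv (A : set R) : measurable A -> A `<=` `[0, 1]%classic ->
  uniform_prob (@ltr01 R) A = lebesgue_measure A.
Proof.
move=> mA A01; rewrite /uniform_prob.
rewrite (eq_integral (cst 1%:E)) ?integral_cst ?mul1e//.
move=> x; rewrite inE => /A01/=; rewrite in_itv/= /uniform_pdf => ->.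
by rewrite subr0 invr1.
Qed.

Lemma pr_uniform (k : 'I_d) (a b : R) : 0 <= a -> a <= b -> b <= 1 ->
  pr P (U k @^-1` `[a, b[%classic) = b - a.
Proof.
move=> a0 ab b1; have := unifU k (measurable_itv `[a, b[).
rewrite uniform_prob_subitv//; last first.
  move=> x /=; rewrite !in_itv/= => /andP[ax xb].
  by rewrite (le_trans a0)//= (le_trans (ltW xb)).
rewrite lebesgue_measure_itv/= lte_fin /pr => E.
rewrite (_ : P _ = distribution P (U k) `[a, b[%classic)// E.
case: ltP => //= ba; apply/esym/eqP; rewrite subr_eq0.
by rewrite eq_le ba ab.
Qed.

Section grid.
Variable N : nat.

Local Notation level := (@level R N).

Definition slab (k : 'I_d) (i : nat) : set T :=
  U k @^-1` `[level i, level i.+1[%classic.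

Definition cell (a : {ffun 'I_d -> 'I_N.+1}) : set T :=
  \bigcap_(k in [set` fset_set [set: 'I_d]]) slab k (a k).

Lemma cellE a w : cell a w <-> forall k, slab k (a k) w.
Proof.
by rewrite /cell fset_setK; [split => [H k|H k _]; exact: H|exact: finite_finset].
Qed.

Lemma measurable_slab k i : measurable (slab k i).
Proof. by apply: measurable_funPTI => //; exact: measurable_itv. Qed.

Lemma measurable_cell a : measurable (cell a).
Proof.
apply: fin_bigcap_measurable => [|k _]; last exact: measurable_slab.
exact: finite_finset.
Qed.

Lemma pr_slab k (i : nat) : (i <= N)%N -> pr P (slab k i) = N.+1%:R^-1.
Proof.
move=> iN; rewrite pr_uniform.
- by rewrite levelS addrAC subrr add0r.
- exact: level_ge0.
- by rewrite ler_level.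
- by rewrite level_le1.
Qed.

(** Only the fact that the value does not depend on [a] matters. *)
Lemma pr_cell a : pr P (cell a) =
  \prod_(k <- fset_set [set: 'I_d]) (N.+1%:R^-1 : R).
Proof.
apply: EFin_inj; rewrite -prE; last exact: measurable_cell.
have := indepU (fset_set [set: 'I_d])
  (A := fun k => `[level (a k), level (a k).+1[%classic).
rewrite /cell /slab => ->; last by move=> k; exact: measurable_itv.
rewrite -prodEFin; apply: eq_bigr => k _.
rewrite -(pr_slab k (ltn_ord (a k) : (a k <= N)%N)).
by apply: prE; exact: measurable_slab.
Qed.

Lemma trivIset_cell : trivIset setT cell.
Proof.
move=> a b _ _ [w [/cellE aw /cellE bw]].
apply/ffunP => k; apply/val_inj/eqP; rewrite eqn_leq.
move: (aw k) (bw k); rewrite /slab/= !in_itv/= => /andP[a1 a2] /andP[b1 b2].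
by apply/andP; split; rewrite -ltnS -(@ltr_level R N);
  [exact: le_lt_trans b2|exact: le_lt_trans a2].
Qed.

Let k0 : 'I_d := Ordinal d_gt0.

(** The distance of a cell to the lower boundary along the diagonal. *)
Definition low (a : {ffun 'I_d -> 'I_N.+1}) : nat := a [arg min_(k < k0) a k].

Lemma low_le a k : (low a <= a k)%N.
Proof. by rewrite /low; case: arg_minnP => // i _; exact. Qed.

(** The cell on the lower boundary lying on the same diagonal. *)
Definition slide (a : {ffun 'I_d -> 'I_N.+1}) : {ffun 'I_d -> 'I_N.+1} :=
  [ffun k => inord (a k - low a)].

Lemma slideE a k : slide a k = (a k - low a)%N :> nat.
Proof. by rewrite ffunE inordK// (leq_ltn_trans (leq_subr _ _)). Qed.

Lemma slide_boundary a : exists k, slide a k = 0%N :> nat.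
Proof. by exists [arg min_(k < k0) a k]; rewrite slideE subnn. Qed.

(** Sliding along the diagonal is injective on the cells that meet the level
    set: of two cells of one diagonal, one lies strictly above the other in
    every coordinate, so the product takes different values on them. As all cells have
    the same probability, the level set is no more likely than the boundary
    cells, which are contained in the [d] bottom slabs. *)
Lemma pr_prod_eq_grid (t : R) :
  pr P [set w | \prod_(k < d) U k w = t] <= d%:R / N.+1%:R.
Proof.
pose A := [set w | \prod_(k < d) U k w = t].
pose S := [set a | `[< exists2 w, cell a w & A w >]]%SET.
have prod_lt a b w v : cell a w -> cell b v -> (forall k, a k < b k)%N ->
    \prod_(k < d) U k w < \prod_(k < d) U k v.
  move=> /cellE aw /cellE bv ab; apply: ltr_prod.
    by apply/hasP; exists k0; rewrite ?mem_index_enum.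
  move=> k _; move: (aw k) (bv k); rewrite /slab/= !in_itv/=.
  move=> /andP[a1 a2] /andP[b1 _]; rewrite (le_trans (level_ge0 _ _) a1)/=.
  by rewrite (lt_le_trans a2)// (le_trans _ b1)// ler_level.
have slide_inj : {in S &, injective slide}.
  suff wl a b : a \in S -> b \in S -> slide a = slide b ->
      (low a <= low b)%N -> a = b.
    move=> a b aS bS ab; have [|/ltnW] := leqP (low a) (low b); first exact: wl.
    by move=> ba; apply/esym; apply: wl.
  rewrite !inE => -[w aw Aw] [v bv Av] sab lab.
  have E k : (a k + low b = b k + low a)%N.
    have := congr1 (fun f : {ffun 'I_d -> 'I_N.+1} => f k : nat) sab.
    rewrite /= !slideE; move: (low_le a k) (low_le b k); lia.
  move: lab; rewrite leq_eqVlt => /orP[/eqP lab|lab].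
    by apply/ffunP => k; apply/val_inj/eqP; rewrite -(eqn_add2r (low b)) E lab.
  have : \prod_(k < d) U k w < \prod_(k < d) U k v.
    by apply: prod_lt aw bv _ => k; rewrite -(ltn_add2r (low a)) -E ltn_add2l.
  by rewrite Aw Av ltxx.
pose out k := ~` (U k @^-1` `[0, 1[%classic).
have mU k : measurable (U k @^-1` `[0, 1[%classic).
  by apply: measurable_funPTI => //; exact: measurable_itv.
have mout k : measurable (out k) by exact: measurableC.
have out0 k : pr P (out k) = 0 by rewrite prC// pr_uniform// subr0 subrr.
have mA : measurable A.
  rewrite (_ : A = (fun w => \prod_(k < d) U k w) @^-1` [set t])//.
  rewrite -[X in measurable X]setTI.
  have mp : measurable_fun setT (fun w => \prod_(k < d) U k w).
    by apply: measurable_prod => k _; exact: measurable_funPT.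
  exact: mp.
have mO : measurable (\big[setU/set0]_(k < d) out k) by exact: bigsetU_measurable.
have mC (Q : pred {ffun 'I_d -> 'I_N.+1}) :
    measurable (\big[setU/set0]_(a | Q a) cell a).
  by apply: bigsetU_measurable => a _; exact: measurable_cell.
have mL : measurable (\big[setU/set0]_(k < d) slab k 0).
  by apply: bigsetU_measurable => k _; exact: measurable_slab.
(* outside a null event every point lies in some cell *)
have AS : A `<=` (\big[setU/set0]_(k < d) out k) `|`
    \big[setU/set0]_(a in S) cell a.
  move=> w Aw; have [[k kw]|nout] := pselect (exists k, out k w).
    by left; rewrite -bigcup_seq; exists k => //=; exact: mem_index_enum.
  right.
  have inU k : 0 <= U k w < 1.
    have : (U k @^-1` `[0, 1[%classic) w.
      by apply: contrapT => h; apply: nout; exists k.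
    by rewrite /= in_itv.
  have /choice[m Hm] k : exists i : nat, level i <= U k w < level i.+1.
    by apply: level_bracket; have /andP[] := inU k.
  pose a : {ffun 'I_d -> 'I_N.+1} := [ffun k => inord (m k)].
  have aw : cell a w.
    apply/cellE => k; have /andP[m1 m2] := Hm k.
    have /andP[_ U1] := inU k.
    rewrite /slab/= in_itv/= ffunE inordK ?m1//.
    by rewrite ltnS -(@level_lt1 R N) (le_lt_trans m1).
  rewrite -bigcup_seq_cond; exists a => //=; rewrite mem_index_enum inE/=.
  by apply/asboolP; exists w.
rewrite (le_trans (le_pr P mA _ AS))//; first exact: measurableU.
rewrite (le_trans (prU_le P mO (mC _)))//.
have -> : pr P (\big[setU/set0]_(k < d) out k) = 0.
  apply/eqP; rewrite eq_le pr_ge0 andbT (le_trans (pr_bigU_le _ _ _ mout))//.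
  by rewrite big1.
rewrite add0r pr_bigU ?index_enum_uniq//; last 2 first.
- by move=> a; exact: measurable_cell.
- exact: trivIset_cell.
rewrite (eq_bigr (fun a => pr P (cell (slide a)))); last first.
  by move=> a _; rewrite !pr_cell.
rewrite -(big_imset (fun b => pr P (cell b)) slide_inj)/=.
rewrite -pr_bigU ?index_enum_uniq//; last 2 first.
- by move=> a; exact: measurable_cell.
- exact: trivIset_cell.
apply: (@le_trans _ _ (pr P (\big[setU/set0]_(k < d) slab k 0))).
  apply: le_pr => // w; rewrite -bigcup_seq_cond => -[b /= /andP[_ /imsetP[a _ ->]]].
  move=> /cellE sw; have [k kz] := slide_boundary a.
  rewrite -bigcup_seq; exists k; first exact: mem_index_enum.
  by have := sw k; rewrite kz.
rewrite (le_trans (pr_bigU_le _ _ _ _))//; first by move=> k; exact: measurable_slab.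
rewrite (eq_bigr (fun=> N.+1%:R^-1)); last by move=> k _; exact: pr_slab.
by rewrite sumr_const card_ord mulr_natl.
Qed.

End grid.

Lemma prod_uniform_atomless (t : R) :
  pr P [set w | \prod_(k < d) U k w = t] = 0.
Proof.
apply/eqP; rewrite eq_le pr_ge0 andbT.
have H : d%:R * n.+1%:R^-1 @[n --> \oo] --> (d%:R * 0 : R).
  by apply: cvgMr; exact: cvg_harmonic.
rewrite -[leRHS](mulr0 d%:R) -(cvg_lim _ H)//.
apply: limr_ge; first by apply/cvg_ex; exists (d%:R * 0).
by apply: nearW => n; exact: pr_prod_eq_grid.
Qed.

End uniform_product.

(** * Empirical frequencies *)

Section frequency.
Context {R : realType} {d : nat}.
Implicit Types (A B : set (d.-tuple R)) (y : nat -> d.-tuple R).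

Definition freq (n : nat) y A : R := n%:R^-1 * \sum_(i < n) \1_A (y i).

Lemma freq_le n y A B : A `<=` B -> freq n y A <= freq n y B.
Proof.
move=> AB; rewrite ler_wpM2l ?invr_ge0//; apply: ler_sum => i _.
rewrite !indicE ler_nat; case: (boolP (y i \in A)) => //.
by rewrite inE => /AB yB; rewrite mem_set.
Qed.

Lemma ecdfE n y x : ecdf n y x = freq n y [set z | letuple z x].
Proof.
rewrite /ecdf /freq; congr (_ * _); apply: eq_bigr => i _.
by rewrite indicE; congr (nat_of_bool _)%:R; apply/idP/idP; rewrite inE.
Qed.

(** The weighted frequencies are the empirical mean of the step function with
    value [c k] on [J k]. *)
Lemma mean_step_close n y (I : finType) (J : I -> set (d.-tuple R)) (c : I -> R)
    (f : d.-tuple R -> R) (e : R) : 0 <= e ->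
  trivIset setT J -> (forall z, exists k, J k z) ->
  (forall i k, J k (y i) -> `|f (y i) - c k| <= e) ->
  `|n%:R^-1 * \sum_(i < n) f (y i) - \sum_k c k * freq n y (J k)| <= e.
Proof.
move=> e0 tJ cJ fc.
have -> : \sum_k c k * freq n y (J k) =
    n%:R^-1 * \sum_(i < n) \sum_k c k * \1_(J k) (y i).
  rewrite exchange_big/= mulr_sumr; apply: eq_bigr => k _.
  by rewrite /freq mulrCA mulr_sumr.
rewrite -mulrBr -sumrB normrM normfV normr_nat.
have [->|n0] := posnP n; first by rewrite invr0 mul0r.
rewrite ler_pdivrMl ?ltr0n//; apply: le_trans (ler_norm_sum _ _ _) _.
rewrite mulr_natl -[X in _ *+ X]card_ord -sumr_const; apply: ler_sum => i _.
have [k Jk] := cJ (y i).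
rewrite (bigD1 k)//= big1 ?addr0; last first.
  move=> l lk; rewrite indicE memNset ?mulr0// => Jl.
  by move: lk; rewrite (tJ l k Logic.I Logic.I) ?eqxx//; exists (y i).
by rewrite indicE mem_set// mulr1; exact: fc.
Qed.

End frequency.

(** * Uniform convergence of the empirical distribution function *)

Section glivenko_cantelli.
Context {disp : measure_display} {T : measurableType disp} {R : realType}.
Variables (P : probability T R) (d : nat) (Y : {RV P >-> d.-tuple R}).
Hypothesis contY : forall k : 'I_d,
  continuous (real_cdf (coordinate k \o Y : {RV P >-> R})).

Definition law (A : set (d.-tuple R)) : R := pr P (Y @^-1` A).

Let marginal (k : 'I_d) : R -> R := real_cdf (coordinate k \o Y : {RV P >-> R}).

Lemma measurable_preY A : measurable A -> measurable (Y @^-1` A).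
Proof. by move=> mA; exact: measurable_funPTI. Qed.

Lemma law_le A B : measurable A -> measurable B -> A `<=` B -> law A <= law B.
Proof.
by move=> mA mB AB; apply: le_pr; [exact: measurable_preY..|move=> w; exact: AB].
Qed.

Lemma measurable_letuple (x : d.-tuple R) : measurable [set z | letuple z x].
Proof.
rewrite (_ : [set z | _] = \bigcap_(k in [set: 'I_d])
    (coordinate k @^-1` `]-oo, tnth x k]%classic)); last first.
  apply/seteqP; split => z /=; first by move=> /forallP H k _; rewrite /= in_itv/= H.
  by move=> H; apply/forallP => k; have := H k Logic.I; rewrite /= in_itv.
apply: fin_bigcap_measurable => [|k _]; first exact: finite_finset.
by apply: measurable_funPTI => //; exact: measurable_itv.
Qed.

Lemma joint_cdfE x : joint_cdf Y x = law [set z | letuple z x].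
Proof. by []. Qed.

Lemma joint_cdf_ge0 x : 0 <= joint_cdf Y x.
Proof. by rewrite joint_cdfE; exact: pr_ge0. Qed.

Lemma joint_cdf_le1 x : joint_cdf Y x <= 1.
Proof.
rewrite joint_cdfE; apply: pr_le1; apply: measurable_preY.
exact: measurable_letuple.
Qed.

Section grid.
Variable N : nat.
Local Notation level := (@level R N).

(** Lower orthants with vertices on the grid, expressed through the marginal
    levels rather than through quantiles, so that no infinite vertices arise.
    Indices run up to [N + 2] because the value 1 of a marginal lies in the
    slice from level [N + 1] to level [N + 2]. *)
Definition corner (a : {ffun 'I_d -> 'I_N.+3}) : set (d.-tuple R) :=
  [set z | forall k, marginal k (tnth z k) < level (a k)].

Lemma measurable_corner a : measurable (corner a).
Proof.
rewrite (_ : corner a = \bigcap_(k in [set: 'I_d])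
    [set z | marginal k (coordinate k z) < level (a k)]); last first.
  by apply/seteqP; split => z /= H k => [_|]; apply: H.
apply: fin_bigcap_measurable => [|k _]; first exact: finite_finset.
rewrite -[X in measurable X]setTI; apply: measurable_fun_ltr => //.
apply: measurableT_comp; first exact: measurable_real_cdf.
exact: measurable_coordinate.
Qed.

(** Round the marginal levels of [x] down and up. The two corners differ by
    points with some coordinate in the same marginal slice as [x], and each of these
    [d] slices has small probability. *)
Lemma corner_bracket (x : d.-tuple R) : exists a b,
  [/\ corner a `<=` [set z | letuple z x],
      [set z | letuple z x] `<=` corner b &
      law (corner b) - law (corner a) <= d%:R * (2 / N.+1%:R)].
Proof.
have /choice[m Hm] k : exists i : nat,
    level i <= marginal k (tnth x k) < level i.+1.
  by apply: level_bracket; exact: real_cdf_ge0.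
have mN k : (m k <= N.+1)%N.
  have /andP[m1 _] := Hm k; rewrite -(@level_le1 R N) (le_trans m1)//.
  exact: real_cdf_le1.
pose a : {ffun 'I_d -> 'I_N.+3} := [ffun k => inord (m k)].
pose b : {ffun 'I_d -> 'I_N.+3} := [ffun k => inord (m k).+1].
have aE k : a k = m k :> nat by rewrite ffunE inordK// ltnS ltnW// ltnS.
have bE k : b k = (m k).+1 :> nat by rewrite ffunE inordK// ltnS ltnS.
exists a, b; split.
- move=> z /= Hz; apply/forallP => k; have /andP[m1 _] := Hm k.
  rewrite leNgt; apply/negP => /ltW xz.
  have := @real_cdf_homo _ _ _ P (coordinate k \o Y : {RV P >-> R}) _ _ xz.
  by rewrite leNgt (lt_le_trans _ m1)// -aE; exact: Hz.
- move=> z /= /forallP Hz k; have /andP[_ m2] := Hm k.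
  by rewrite bE (le_lt_trans _ m2)//; exact: real_cdf_homo.
- pose D k := [set w |
    level (m k) <= marginal k ((coordinate k \o Y) w) < level (m k).+1].
  have mD k : measurable (D k).
    rewrite (_ : D k =
        [set w | marginal k ((coordinate k \o Y) w) < level (m k).+1]
        `\` [set w | marginal k ((coordinate k \o Y) w) < level (m k)]).
      by apply: measurableD; exact: measurable_cdf_lt.
    apply/seteqP; split => w; rewrite /D/=.
      by move=> /andP[l ->]; split => //; rewrite ltNge l.
    by move=> [-> /negP]; rewrite -leNgt andbT.
  rewrite lerBlDl; apply: (@le_trans _ _
      (pr P ((Y @^-1` corner a) `|` \big[setU/set0]_(k < d) D k))).
    apply: le_pr; first by apply: measurable_preY; exact: measurable_corner.
      apply: measurableU; first by apply: measurable_preY; exact: measurable_corner.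
      exact: bigsetU_measurable.
    move=> w /= bw; have [[k Dk]|nD] := pselect (exists k, D k w).
      by right; rewrite -bigcup_seq; exists k => //; exact: mem_index_enum.
    left => k; rewrite aE ltNge; apply/negP => mk; apply: nD; exists k.
    by rewrite /D/= mk/= -bE; exact: bw.
  rewrite (le_trans (prU_le _ _ _))//.
  + by apply: measurable_preY; exact: measurable_corner.
  + exact: bigsetU_measurable.
  rewrite lerD2l (le_trans (pr_bigU_le _ _ _ mD))//.
  rewrite mulr_natl -[X in _ *+ X]card_ord -sumr_const; apply: ler_sum => k _.
  by apply: pr_cdf_bucket (mN k); exact: contY.
Qed.

Lemma ecdf_uniform_close n (y : nat -> d.-tuple R) (e : R) :
  (forall a, `|freq n y (corner a) - law (corner a)| <= e) ->
  forall x, `|ecdf n y x - joint_cdf Y x| <= e + d%:R * (2 / N.+1%:R).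
Proof.
move=> He x; have [a [b [ax xb ba]]] := corner_bracket x.
rewrite ecdfE joint_cdfE; set X := [set z | _].
have mX : measurable X by exact: measurable_letuple.
have squeeze (fa fx fb la lx lb c : R) : fa <= fx -> fx <= fb -> la <= lx ->
    lx <= lb -> lb - la <= c -> `|fa - la| <= e -> `|fb - lb| <= e ->
    `|fx - lx| <= e + c by rewrite !ler_norml; lra.
apply: squeeze (freq_le n y ax) (freq_le n y xb) _ _ ba (He a) (He b).
- exact: law_le (measurable_corner a) mX ax.
- exact: law_le mX (measurable_corner b) xb.
Qed.

End grid.

End glivenko_cantelli.

(** * Consistency *)

Section joint_cdf_measurable.
Context {disp : measure_display} {T : measurableType disp} {R : realType}.
Variables (P : probability T R) (d : nat) (Y : {RV P >-> d.-tuple R}).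

(** The value at [x] is the measure of the section at [x] of the order relation,
    which is measurable in the product. *)
Lemma measurable_joint_cdf : measurable_fun setT (joint_cdf Y).
Proof.
pose A := [set xz : d.-tuple R * d.-tuple R | letuple xz.2 xz.1].
have mA : measurable A.
  rewrite (_ : A = \bigcap_(k in [set: 'I_d])
      [set xz | coordinate k xz.2 <= coordinate k xz.1]); last first.
    apply/seteqP; split => xz /=; first by move=> /forallP H k _; exact: H.
    by move=> H; apply/forallP => k; exact: H.
  apply: fin_bigcap_measurable => [|k _]; first exact: finite_finset.
  rewrite -[X in measurable X]setTI; apply: measurable_fun_ler => //.
    exact: (measurableT_comp (measurable_coordinate k) measurable_snd).
  exact: (measurableT_comp (measurable_coordinate k) measurable_fst).
have : measurable_fun setT (fine \o (fun x => distribution P Y (xsection A x))).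
  apply: measurableT_comp; first exact: fine_measurable.
  exact: measurable_fun_xsection.
apply: eq_measurable_fun => x _ /=; rewrite /joint_cdf; congr (fine (_ _)).
by apply/seteqP; split => z; rewrite /xsection/= ?inE.
Qed.

End joint_cdf_measurable.

Section consistency.
Context {disp : measure_display} {T : measurableType disp} {R : realType}.
Variables (P : probability T R) (d : nat).
Variables (Y : {RV P >-> d.-tuple R}) (Ys : nat -> {RV P >-> d.-tuple R}).
Variable V : {RV P >-> R}.
Hypothesis contY : forall k : 'I_d,
  continuous (real_cdf (coordinate k \o Y : {RV P >-> R})).
Hypothesis contV : continuous (real_cdf V).
Hypothesis lawYs : forall i A, measurable A -> pr P (Ys i @^-1` A) = law Y A.
Hypothesis indepYs : forall i j A, i != j -> measurable A ->
  pr P (Ys i @^-1` A `&` Ys j @^-1` A) = law Y A ^+ 2.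
Hypothesis indepVY : forall t A, measurable A ->
  pr P ([set w | t <= V w] `&` Y @^-1` A) = pr P [set w | t <= V w] * law Y A.

Let K := real_cdf V.
Let F := joint_cdf Y.

Lemma ae_freq_cvg A : measurable A ->
  {ae P, forall w, freq n (fun i => Ys i w) A @[n --> \oo] --> law Y A}.
Proof.
move=> mA.
have mB i : measurable (Ys i @^-1` A) by exact: measurable_funPTI.
have := slln_events mB (fun i => lawYs i mA) (fun i j ij => indepYs ij mA).
by apply: filterS => w; exact.
Qed.

Section bins.
Variable N : nat.
Local Notation level := (@level R N).

(** The last bin, [k = N + 1], holds the points where [F] equals 1. *)
Definition bin (k : 'I_N.+2) : set (d.-tuple R) :=
  [set z | level k <= F z < level k.+1].

Lemma measurable_bin k : measurable (bin k).
Proof.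
rewrite (_ : bin k = F @^-1` `[level k, level k.+1[%classic); last first.
  by apply/seteqP; split => z; rewrite /bin/= in_itv.
rewrite -[X in measurable X]setTI; apply: measurable_joint_cdf => //.
Qed.

Lemma trivIset_bin : trivIset setT bin.
Proof.
move=> k l _ _ [z [/andP[k1 k2] /andP[l1 l2]]]; apply/val_inj/eqP.
by rewrite eqn_leq; apply/andP; split; rewrite -ltnS -(@ltr_level R N);
  [exact: le_lt_trans l2|exact: le_lt_trans k2].
Qed.

Lemma bin_cover z : exists k, bin k z.
Proof.
have [i /andP[i1 i2]] := level_bracket N (joint_cdf_ge0 Y z).
have iN : (i < N.+2)%N.
  by rewrite ltnS -(@level_le1 R N) (le_trans i1)// joint_cdf_le1.
by exists (Ordinal iN); rewrite /bin/= i1.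
Qed.

(** On the bin [k] the event [F Y <= V] contains [level (k + 1) <= V] and is
    contained in [level k <= V]; independence of [V] and [Y] factors both, and
    continuity of [K] turns [P (t <= V)] into [1 - K t]. *)
Lemma AUK_step_close (e : R) :
  (forall k : 'I_N.+2, `|K (level k.+1) - K (level k)| <= e) ->
  `|1 - AUK V Y - \sum_(k < N.+2) K (level k) * law Y (bin k)| <= e.
Proof.
move=> Ke.
have mV : measurable_fun setT V by exact: measurable_funPT.
have mge t : measurable [set w | t <= V w].
  by rewrite -[X in measurable X]setTI; exact: measurable_fun_ler.
have prge t : pr P [set w | t <= V w] = 1 - K t.
  have -> : [set w | t <= V w] = ~` [set w | V w <= t] `|` [set w | V w = t].
    apply/seteqP; split => w /=; last by case=> [/negP|->//]; rewrite -ltNge => /ltW.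
    rewrite le_eqVlt => /orP[/eqP ->|]; first by right.
    by left; apply/negP; rewrite -ltNge.
  rewrite prU; [|exact: measurableC (measurable_le_cst V t)
    |exact: measurable_eq_cst|]; last first.
    by apply/disj_set2P; rewrite -subset0 => w [/= + Vt]; rewrite Vt lexx.
  by rewrite (atomless_of_continuous contV) addr0 prC ?real_cdfE//;
    exact: measurable_le_cst.
pose J k := Y @^-1` bin k.
have mJ k : measurable (J k) by apply: measurable_preY; exact: measurable_bin.
have tJ : trivIset setT J.
  by move=> k l _ _ [w kl]; apply: trivIset_bin => //; exists (Y w).
have cJ w : exists k, J k w by exact: bin_cover.
pose A := [set w | F (Y w) <= V w].
have mA : measurable A.
  rewrite -[X in measurable X]setTI; apply: measurable_fun_ler => //.
  by apply: measurableT_comp; [exact: measurable_joint_cdf|exact: measurable_funPT].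
have AE : AUK V Y = \sum_k pr P (A `&` J k) by rewrite -(pr_partition P mA mJ tJ cJ).
have J1 : 1 = \sum_k law Y (bin k).
  rewrite -(prT P) (pr_partition P measurableT mJ tJ cJ).
  by apply: eq_bigr => k _; rewrite setTI.
have up (k : 'I_N.+2) : pr P (A `&` J k) <= (1 - K (level k)) * law Y (bin k).
  rewrite -prge -indepVY; last exact: measurable_bin.
  apply: le_pr; [exact: measurableI mA (mJ k)|exact: measurableI (mge _) (mJ k)|].
  by move=> w [Aw Jw]; split => //=; case/andP: Jw => l _; exact: le_trans Aw.
have lo (k : 'I_N.+2) : (1 - K (level k.+1)) * law Y (bin k) <= pr P (A `&` J k).
  rewrite -prge -indepVY; last exact: measurable_bin.
  apply: le_pr; [exact: measurableI (mge _) (mJ k)|exact: measurableI mA (mJ k)|].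
  by move=> w [/= Vw Jw]; split => //=; case/andP: Jw => _ l; exact: le_trans (ltW l) _.
have -> : 1 - AUK V Y - \sum_(k < N.+2) K (level k) * law Y (bin k) =
    \sum_(k < N.+2) ((1 - K (level k)) * law Y (bin k) - pr P (A `&` J k)).
  rewrite AE sumrB.
  under [in RHS]eq_bigr do rewrite mulrBl mul1r.
  by rewrite sumrB -J1 addrAC.
rewrite ger0_norm; last by apply: sumr_ge0 => k _; rewrite subr_ge0.
rewrite -[leRHS]mulr1 [in leRHS]J1 mulr_sumr; apply: ler_sum => k _.
apply: (@le_trans _ _ ((K (level k.+1) - K (level k)) * law Y (bin k))).
  have arith (u u' l q : R) : (1 - u') * l <= q ->
      (1 - u) * l - q <= (u' - u) * l.
    by rewrite !mulrBl; lra.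
  exact: arith (lo k).
by rewrite ler_wpM2r ?pr_ge0// (le_trans (ler_norm _)).
Qed.

End bins.

Theorem AUK_hat_consistent :
  {ae P, forall w, AUK_hat K n (fun i => Ys i w) @[n --> \oo] --> AUK V Y}.
Proof.
have aeC : {ae P, forall w, forall N (a : {ffun 'I_d -> 'I_N.+3}),
    freq n (fun i => Ys i w) (corner Y a) @[n --> \oo] --> law Y (corner Y a)}.
  apply/ae_foralln => N.
  apply: (@filter_forall _ _ (fun a w =>
    freq n (fun i => Ys i w) (corner Y a) @[n --> \oo] --> law Y (corner Y a))).
  by move=> a; apply: ae_freq_cvg; exact: measurable_corner.
have aeB : {ae P, forall w, forall N (k : 'I_N.+2),
    freq n (fun i => Ys i w) (bin k) @[n --> \oo] --> law Y (bin k)}.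
  apply/ae_foralln => N.
  apply: (@filter_forall _ _ (fun k w =>
    freq n (fun i => Ys i w) (bin k) @[n --> \oo] --> law Y (bin k))).
  by move=> k; apply: ae_freq_cvg; exact: measurable_bin.
move: aeC aeB; apply: filterS2 => w cvgC cvgB.
set y := fun i => Ys i w; apply/cvgrPdist_lt => e e0.
have e4 : 0 < e / 4 by rewrite divr_gt0.
have [dl dl0 Hdl] := @heine_segment R K 0 1 contV _ e4.
(* the mesh costs 2 d / (N + 1) in the uniform bound for ecdf and 1 / (N + 1)
   for the distance of F to the bin level; the frequencies use dl / 4 more *)
have [N HN] : exists N : nat, (2 * d%:R + 1) * N.+1%:R^-1 < dl / 2.
  have H : (2 * d%:R + 1) * n.+1%:R^-1 @[n --> \oo] --> ((2 * d%:R + 1) * 0 : R).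
    by apply: cvgMr; exact: cvg_harmonic.
  have dl2 : (2 * d%:R + 1) * 0 < dl / 2 by rewrite mulr0 divr_gt0.
  by have /cvgr_lt/(_ _ dl2)[N _ HN] := H; exists N; exact: HN (leqnn N).
have dlh : dl / 2 < dl by lra.
have N0 : 0 < N.+1%:R^-1 :> R by rewrite invr_gt0.
have Nd : N.+1%:R^-1 <= (2 * d%:R + 1) * N.+1%:R^-1 :> R.
  by rewrite ler_peMl ?(ltW N0)// lerDr mulr_ge0.
have fC := cvgC N; have fB := cvgB N.
have dl4 : 0 < dl / 4 by rewrite divr_gt0.
have AUKs : `|1 - AUK V Y - \sum_(k < N.+2) K (level N k) * law Y (bin k)| <= e / 4.
  apply: AUK_step_close => k; rewrite distrC ltW// Hdl//.
    by rewrite level_ge0 level_le1 -ltnS ltn_ord.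
  rewrite levelS opprD addrA subrr add0r normrN gtr0_norm//.
  by rewrite (le_lt_trans Nd)// (lt_trans HN).
have H1 : \forall n \near \oo, forall a : {ffun 'I_d -> 'I_N.+3},
    `|freq n y (corner Y a) - law Y (corner Y a)| <= dl / 4.
  apply: filter_forall => a; move/cvgrPdist_le : (fC a) => /(_ _ dl4).
  by apply: filterS => n; rewrite distrC.
have H2 : \forall n \near \oo,
   `|\sum_(k < N.+2) K (level N k) * law Y (bin k) -
      \sum_(k < N.+2) K (level N k) * freq n y (bin k)| < e / 4.
  have H : \sum_(k < N.+2) K (level N k) * freq n y (bin k) @[n --> \oo] -->
      \sum_(k < N.+2) K (level N k) * law Y (bin k).
    apply: cvg_big => [|k _]; first exact: add_continuous.
    by apply: cvgMr; exact: fB.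
  by move/cvgrPdist_lt : H => /(_ _ e4).
near=> n.
have C1 : `|n%:R^-1 * \sum_(i < n) K (ecdf n y (y i)) -
    \sum_(k < N.+2) K (level N k) * freq n y (bin k)| <= e / 4.
  apply: (@mean_step_close _ _ n y _ (@bin N)
    (fun k : 'I_N.+2 => K (level N k)) (fun z => K (ecdf n y z))).
  - exact: ltW.
  - exact: trivIset_bin.
  - exact: bin_cover.
  move=> i k /andP[k1 k2]; rewrite distrC ltW// Hdl//.
    by rewrite level_ge0 level_le1 -ltnS ltn_ord.
  have E : `|ecdf n y (y i) - F (y i)| <= dl / 4 + d%:R * (2 / N.+1%:R).
    by apply: ecdf_uniform_close => //; near: n.
  have {}E : `|ecdf n y (y i) - F (y i)| <= dl / 4 + (2 * d%:R) * N.+1%:R^-1.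
    by rewrite [2 * _]mulrC -mulrA.
  move: k2; rewrite levelS => k2.
  move: HN E; rewrite mulrDl mul1r.
  move: (2 * d%:R * N.+1%:R^-1) => D HN E.
  move: k1 k2 N0 HN E; rewrite ler_norml ltr_norml.
  move: (N.+1%:R^-1) => c; move: (level N k) (F (y i)) (ecdf _ _ _) => l f g.
  by move=> ? ? ? ? /andP[? ?]; apply/andP; split; lra.
have C2 : `|\sum_(k < N.+2) K (level N k) * law Y (bin k) -
      \sum_(k < N.+2) K (level N k) * freq n y (bin k)| < e / 4.
  by near: n.
move: AUKs C1 C2; rewrite /AUK_hat.
move: (n%:R^-1 * _) (\sum_(k < N.+2) _) (\sum_(k < N.+2) _) (AUK _ _) => m s1 s2 u.
rewrite !ltr_norml !ler_norml => /andP[? ?] /andP[? ?] /andP[? ?].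
by apply/andP; split; lra.
Unshelve. all: by end_near. Qed.

End consistency.

(** * Reflected samples *)

Section independence.
Context {disp : measure_display} {T : measurableType disp} {R : realType}.
Variable P : probability T R.

Lemma mutually_independent_pair (I : choiceType) (disp' : measure_display)
    (E : measurableType disp') (X : I -> {mfun T >-> E}) (i j : I) (A : set E) :
  mutually_independent P (fun k => X k : T -> E) -> i != j -> measurable A ->
  pr P (X i @^-1` A `&` X j @^-1` A) = pr P (X i @^-1` A) * pr P (X j @^-1` A).
Proof.
move=> indepX ij mA.
have mX k : measurable (X k @^-1` A) by exact: measurable_funPTI.
apply: EFin_inj; rewrite EFinM -!prE//; last exact: measurableI.
have := indepX [fset i; j]%fset (fun=> A) (fun=> mA).
rewrite big_fsetU1/= ?inE// big_seq_fset1 => <-; congr (P _).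
apply/seteqP; split => w /=.
  by move=> [wi wj] k /=; rewrite !inE => /orP[] /eqP ->.
by move=> H; split; apply: H; rewrite /= !inE eqxx ?orbT.
Qed.

Lemma independent_pair_pr (disp1 disp2 : measure_display)
    (E1 : measurableType disp1) (E2 : measurableType disp2)
    (X : {mfun T >-> E1}) (Y : {mfun T >-> E2}) (A : set E1) (B : set E2) :
  independent_pair P X Y -> measurable A -> measurable B ->
  pr P (X @^-1` A `&` Y @^-1` B) = pr P (X @^-1` A) * pr P (Y @^-1` B).
Proof.
move=> indepXY mA mB.
have mXA : measurable (X @^-1` A) by exact: measurable_funPTI.
have mYB : measurable (Y @^-1` B) by exact: measurable_funPTI.
apply: EFin_inj; rewrite EFinM -!prE//; last exact: measurableI.
exact: indepXY.
Qed.

(** A change of sign preserves the absence of atoms, though not the distribution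
    function itself. *)
Lemma reflected_marginal_continuous (d : nat) (X : {RV P >-> d.-tuple R})
    (s : d.-tuple R) (k : 'I_d) : sign_vectors s ->
  continuous (cdf (coordinate k \o X : {RV P >-> R})) ->
  continuous (real_cdf (coordinate k \o (diag_act s \o X) : {RV P >-> R})).
Proof.
move=> /(_ k) sk cX; apply: continuous_of_atomless => t.
have aX := atomless_of_continuous (continuous_real_cdf cX) (tnth s k * t).
apply/eqP; rewrite eq_le pr_ge0 andbT -aX; apply: le_pr.
- exact: (measurable_eq_cst (coordinate k \o (diag_act s \o X) : {RV P >-> R})).
- exact: (measurable_eq_cst (coordinate k \o X : {RV P >-> R})).
move=> w /= <-; rewrite /coordinate /diag_act tnth_mktuple mulrA.
by case: sk => ->; rewrite ?mulrNN mulr1 mul1r.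
Qed.

End independence.

Unset Implicit Arguments.

Theorem mainTheorem3 (R : realType) (disp : measure_display)
    (Omega : measurableType disp) (P : probability Omega R)
    (d : nat) (d_gt0 : (0 < d)%N)
    (X : {RV P >-> d.-tuple R})
    (U : {RV P >-> d.-tuple R})
    (U_uniform : forall k : 'I_d, uniform01 (coordinate k \o U : {RV P >-> R}))
    (U_independent : mutually_independent P (fun k : 'I_d => coordinate k \o U))
    (UX_independent : independent_pair P U X)
    (X_continuous : forall k : 'I_d,
      continuous (cdf (coordinate k \o X : {RV P >-> R})))
    (Xs : nat -> {RV P >-> d.-tuple R})
    (Xs_independent :
      mutually_independent P (fun i => Xs i : Omega -> d.-tuple R))
    (Xs_copies : forall i, identically_distributed (Xs i) X)
    (s : 'I_(2 ^ d) -> d.-tuple R)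
    (s_enum : set_bij [set: 'I_(2 ^ d)] sign_vectors s) :
  let Pi : {RV P >-> R} := coord_prod \o U in
  forall j : 'I_(2 ^ d),
    {ae P, forall w,
      AUK_hat (real_cdf Pi) n (fun i => diag_act (s j) (Xs i w)) @[n --> \oo]
        --> AUK Pi (diag_act (s j) \o X : {RV P >-> d.-tuple R})}.
Proof.
move=> Pi j; set sj := s j.
have sjP : sign_vectors sj by case: s_enum => + _ _; apply.
have mdiag A : measurable A -> measurable (diag_act sj @^-1` A).
  by move=> mA; exact: measurable_funPTI.
pose Y : {RV P >-> d.-tuple R} := diag_act sj \o X.
pose Ys i : {RV P >-> d.-tuple R} := diag_act sj \o Xs i.
apply: (@AUK_hat_consistent _ _ _ P d Y Ys Pi).
- by move=> k; exact: reflected_marginal_continuous (X_continuous k).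
- apply: continuous_of_atomless => t.
  exact: (prod_uniform_atomless d_gt0
    (U := fun k => coordinate k \o U : {RV P >-> R}) U_uniform U_independent).
- by move=> i A /mdiag mA; rewrite /pr; congr fine; exact: (Xs_copies _ _ mA).
- move=> i k A ik /mdiag mA.
  rewrite (mutually_independent_pair Xs_independent ik mA) expr2.
  by congr (_ * _); rewrite /pr; congr fine; exact: (Xs_copies _ _ mA).
- move=> t A /mdiag mA.
  have mt : measurable [set u : d.-tuple R | t <= coord_prod u].
    by rewrite -[X in measurable X]setTI; apply: measurable_fun_ler.
  exact: independent_pair_pr UX_independent mt mA.
Qed.
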